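(* Let $\nu>0$ and let $F\in V'$ with $F\ge0$. Let $\{f_n\}$ be a sequence in $L^\infty_\nu(\Omega)$ with $0\le f_n\le F$ for all $n\in\mathbb{N}$ and $\lim_{n\to\infty} f_n=f^*$ in $L^\infty(\Omega)$ for some $f^*$. Suppose that the increasing map $\Phi:H^+\to H^+$ satisfies Assumption (A) (stated in the context), and that $\lambda\Phi(y)\ge\Phi(\lambda y)$ for any $\lambda>1$ and any $y\in H^+$. Then: (i) the minimal solutions satisfy $\mathbf{m}(f_n)\to\mathbf{m}(f^* )$ in $H$ and $\mathbf{m}(f_n)\rightharpoonup\mathbf{m}(f^* )$ in $V$; (ii) the maximal solutions satisfy $\mathbf{M}(f_n)\to\mathbf{M}(f^* )$ in $H$ and $\mathbf{M}(f_n)\rightharpoonup\mathbf{M}(f^* )$ in $V$.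
   Context: $(V,H,V')$ is a Gelfand triple of Hilbert spaces: $V\hookrightarrow H\hookrightarrow V'$ with dense and continuous embeddings, $H$ identified with $H'$; $\langle\cdot,\cdot\rangle$ is the duality pairing of $V'$ and $V$, $(\cdot,\cdot)$ the inner product of $H$. $H^+\subset H$ is a closed convex cone with $H^+=\{v\in H:(v,y)\ge0\ \forall y\in H^+\}$, and $x\le y$ means $y-x\in H^+$. For $x\in H$, $x^+$ is the orthogonal projection of $x$ onto $H^+$ and $x^-:=x^+-x$; $\sup(x,y):=x+(y-x)^+$, $\inf(x,y):=x-(x-y)^+$. It is assumed that $y\in V$ implies $y^+\in V$, and $\|y^+\|_V\le M\|y\|_V$ for all $y\in V$ and some $M>0$. $V$ and $H$ are spaces of functions $h:\Omega\to\mathbb{R}$ on an open set $\Omega\subset\mathbb{R}^N$, with $L^\infty(\Omega)\hookrightarrow H$ densely and continuously, and $L^\infty(\Omega)$ inherits the order of $H$ (prototype: $V=H_0^1(\Omega)$, $H=L^2(\Omega)$, $H^+$ the a.e. non-negative functions). In $V'$, $f_1\le f_2$ means $\langle f_2-f_1,v\rangle\ge0$ for all $v\in V$ with $v\ge0$. $L^\infty_\nu(\Omega):=\{z\in L^\infty(\Omega): z(x)\ge\nu \text{ for a.a. } x\in\Omega\}$. For $x\le y$ in $H$, $[x,y]:=\{z\in H:x\le z\le y\}$. $A:V\to V'$ (possibly nonlinear) is: homogeneous of order one ($A(tu)=tA(u)$ for $u\in V$, $t>0$); Lipschitz continuous ($\|A(u)-A(v)\|_{V'}\le C\|u-v\|_V$);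 strongly monotone ($\langle A(u)-A(v),u-v\rangle\ge c\|u-v\|_V^2$ for some $c>0$); and T-monotone ($\langle A(u)-A(v),(u-v)^+\rangle\ge0$ for all $u,v\in V$, with equality if and only if $(u-v)^+=0$). $\Phi:H^+\to H^+$ is increasing ($0\le v\le w$ implies $\Phi(v)\le\Phi(w)$), extended to $H$ by $x\mapsto\Phi(x^+)$ when needed. For $\psi\in H^+$, $\mathbf{K}(\psi):=\{v\in V:v\le\psi\}$; for $f\in V'$, $S(f,\psi)$ is the unique $y\in\mathbf{K}(\psi)$ with $\langle A(y)-f,v-y\rangle\ge0$ for all $v\in\mathbf{K}(\psi)$. Let $\overline{y}\in V$ be the unique solution of $A(\overline{y})=F$. For $f\in V'$ with $0\le f\le F$, the set of fixed points of $y\mapsto S(f,\Phi(y))$ in $[0,\overline{y}]$ is non-empty and has a smallest and a largest element; $\mathbf{m}(f)$ and $\mathbf{M}(f)$ denote the smallest and the largest such fixed point, respectively (the minimal and maximal solutions in $[0,\overline{y}]$ of the quasi-variational inequality: find $y\in\mathbf{K}(\Phi(y))$ with $\langle A(y)-f,v-y\rangle\ge0$ for all $v\in\mathbf{K}(\Phi(y))$). Assumption (A): $\Phi$ satisfies one of the following. (a) Whenever $v_n\rightharpoonup v$ in $V$, either $\Phi(v_n)\to\Phi(v)$ in $L^\infty_\nu(\Omega)$ (i.e. these elements lie in $L^\infty_\nu(\Omega)$ and converge in $L^\infty(\Omega)$), or $\Phi(v_n)\to\Phi(v)$ in $V$. (b) Whenever $v_n\rightharpoonup v$ in $V$, $\Phi(v_n)\to\Phi(v)$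 in $H$; and there is a strongly monotone $\mathcal{Q}\in\mathscr{L}(V,V')$ (bounded linear) with $\langle\mathcal{Q}v^-,v^+\rangle\le0$ for all $v\in V$ such that for every $v\in V\cap H^+$ one has $\Phi(v)\in V$ and $\mathcal{Q}\Phi(v)\ge0$ in $V'$.
   Formalization: The formal statement also assumes that sup(x,y)=x+(y-x)^+ is the least upper bound for the order of H (not implied by self-duality, and needed for m(f), M(f) to exist), and that the order inherited by L^∞ is the a.e. pointwise one. *)

(* Defs.v *)
From HB Require Import structures.
From mathcomp Require Import all_boot all_order all_algebra.
From mathcomp Require Import all_classical all_reals all_analysis.
From mathcomp Require Import ring lra.

Set Implicit Arguments.
Unset Strict Implicit.
Unset Printing Implicit Defensive.
Import Order.TTheory GRing.Theory Num.Theory.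
Import numFieldNormedType.Exports.

Local Open Scope classical_set_scope.
Local Open Scope ring_scope.

HB.mixin Record isHilbert (R : realType) H & CompleteNormedModule R H := {
  dot : H -> H -> R;
  dotC : forall x y, dot x y = dot y x;
  dotDl : forall x y z, dot (x + y) z = dot x z + dot y z;
  dotZl : forall a x y, dot (a *: x) y = a * dot x y;
  dot_norm : forall x, dot x x = `|x| ^+ 2 }.

#[short(type=hilbertType)]
HB.structure Definition Hilbert (R : realType) :=
  {H of isHilbert R H & CompleteNormedModule R H}.

Section cauchy_schwarz.
Context (R : realType) (H : hilbertType R).
Implicit Types x y z : H.

Lemma dotDr x y z : dot x (y + z) = dot x y + dot x z.
Proof. by rewrite dotC dotDl !(dotC x). Qed.

Lemma dotZr a x y : dot x (a *: y) = a * dot x y.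
Proof. by rewrite dotC dotZl (dotC x). Qed.

Lemma dot_le x y : dot x y <= `|x| * `|y|.
Proof.
have h a b : 0 <= a ^+ 2 * `|x| ^+ 2 + 2 * (a * b * dot x y)
    + b ^+ 2 * `|y| ^+ 2.
  have : 0 <= dot (a *: x + b *: y) (a *: x + b *: y) by rewrite dot_norm sqr_ge0.
  rewrite !(dotDl, dotDr, dotZl, dotZr) (dotC y x) !dot_norm.
  congr (0 <= _); rewrite !expr2 mulr_natl mulr2n; ring.
have := h `|y| (- `|x|).
have [->|x0] := eqVneq x 0.
  by rewrite -(scale0r (0 : H)) dotZl mul0r scale0r normr0 mul0r.
have [->|y0] := eqVneq y 0.
  by rewrite -(scale0r (0 : H)) dotZr mul0r scale0r normr0 mulr0.
have nx : 0 < `|x| by rewrite normr_gt0.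
have ny : 0 < `|y| by rewrite normr_gt0.
rewrite (_ : _ + _ = 2 * (`|x| * `|y|) * (`|x| * `|y| - dot x y)).
  by rewrite pmulr_rge0 ?subr_ge0// mulr_gt0// mulr_gt0.
rewrite !expr2; ring.
Qed.

End cauchy_schwarz.

Section dual_space.
Context (R : realType) (V : normedModType R).

Definition dual_pred : {pred V -> R^o} :=
  [pred f : V -> R^o | `[< linear f /\ continuous f >]].

Lemma dual_submod_closed : submod_closed dual_pred.
Proof.
split=> [|a f g /asboolP[lf cf] /asboolP[lg cg]]; apply/asboolP; split.
- by move=> a u v; rewrite /= scaler0 addr0.
- exact: cst_continuous.
- move=> b u v; rewrite !fctE lf lg scalerDr !scalerA (mulrC a b) scalerDr.
  by rewrite scalerA addrACA.
- move=> x; apply: cvgD; last exact: cg.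
  by apply: cvgZr; exact: cf.
Qed.

HB.instance Definition _ :=
  GRing.isSubmodClosed.Build R (V -> R^o) dual_pred dual_submod_closed.

Record dual : Type := Dual { dual_fun :> V -> R^o; _ : dual_fun \in dual_pred }.

HB.instance Definition _ := [isSub for dual_fun].
HB.instance Definition _ := [Choice of dual by <:].
HB.instance Definition _ := [SubChoice_isSubLmodule of dual by <:].

Lemma dual_linear (f : dual) : linear f.
Proof. by case: f => f /= /asboolP[]. Qed.

Lemma dual_continuous (f : dual) : continuous f.
Proof. by case: f => f /= /asboolP[]. Qed.

Definition dual_norm (f : dual) : R := sup [set `|f v| | v in [set v | `|v| <= 1]].

Definition weak_cvg (u : nat -> V) (l : V) : Prop :=
  forall f : dual, f (u n) @[n --> \oo] --> f l.

End dual_space.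

Record gelfand (R : realType) (V H : hilbertType R) := Gelfand {
  emb :> {linear V -> H};
  emb_continuous : continuous emb;
  emb_injective : injective emb;
  emb_dense : dense (range emb) }.

Section pivot.
Context (R : realType) (V H : hilbertType R) (G : gelfand V H).

Lemma pivot_subproof (h : H) : (fun v : V => dot h (G v) : R^o) \in @dual_pred R V.
Proof.
apply/asboolP; have lf : linear (fun v : V => dot h (G v) : R^o).
  by move=> a u v; rewrite linearP dotDr dotZr.
split=> //.
have cG := @emb_continuous _ _ _ G.
move=> x; apply/cvgrPdist_lt => e e0.
have h1 : 0 < `|h| + 1 by rewrite ltr_wpDl.
have /cvgrPdist_lt /(_ (e / (`|h| + 1))) := cG x.
rewrite divr_gt0// => /(_ isT); apply: filterS => y.
rewrite ltr_pdivlMr// => hy.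
have -> : dot h (G x) - dot h (G y) = dot h (G x - G y).
  by rewrite dotDr -(scaleN1r (G y)) dotZr mulN1r.
apply: le_lt_trans hy.
apply: (@le_trans _ _ (`|h| * `|G x - G y|)).
  rewrite ler_norml dot_le andbT lerNl.
  have -> : - dot h (G x - G y) = dot (- h) (G x - G y).
    by rewrite -(scaleN1r h) dotZl mulN1r.
  by rewrite (le_trans (dot_le _ _))// normrN.
by rewrite mulrC ler_wpM2l// lerDl.
Qed.

(* H, identified with its dual, as a subspace of the dual of V *)
Definition pivot (h : H) : dual V := Dual (pivot_subproof h).

End pivot.

Section order.
Context (R : realType) (V H : hilbertType R) (G : gelfand V H) (Hp : set H).

Definition hle (x y : H) : Prop := Hp (y - x).

Definition order_itv (x y : H) : set H := [set z | hle x z /\ hle z y].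

Definition pos (x : H) : H :=
  xget 0 [set p | Hp p /\ forall q, Hp q -> `|x - p| <= `|x - q|].

Definition hsup (x y : H) : H := x + pos (y - x).

(* The last clause says that [hsup x y], trivially an upper bound of x and y,
   is their least upper bound. It is not implied by self-duality alone: the
   Lorentz cone of R^3 is self-dual but not a lattice cone. *)
Definition ordering_cone : Prop :=
  [/\ closed Hp,
      (forall t x, 0 <= t -> Hp x -> Hp (t *: x)),
      (forall t x y, 0 <= t <= 1 -> Hp x -> Hp y -> Hp (t *: x + (1 - t) *: y)),
      (forall v, Hp v <-> forall y, Hp y -> 0 <= dot v y)
    & forall x y z, hle x z -> hle y z -> hle (hsup x y) z].

(* v^+ and v^- := v^+ - v as elements of V, which exist under [pos_stable] *)
Definition posV (v : V) : V := xget 0 [set w | G w = pos (G v)].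
Definition negV (v : V) : V := posV v - v.

Definition pos_stable : Prop :=
  (forall v, exists w, G w = pos (G v)) /\
  exists2 M : R, 0 < M & forall v, `|posV v| <= M * `|v|.

Definition dle (f1 f2 : dual V) : Prop := forall v, Hp (G v) -> 0 <= (f2 - f1) v.

(* A sequence of H that lies in V and converges there *)
Definition cvg_V (u : nat -> H) (l : H) : Prop :=
  exists (w : nat -> V) (w0 : V),
    [/\ forall n, G (w n) = u n, G w0 = l & w n @[n --> \oo] --> w0].

Definition strongly_monotone (A : V -> dual V) : Prop :=
  exists2 c : R, 0 < c & forall u v, c * `|u - v| ^+ 2 <= (A u - A v) (u - v).

Definition T_monotone (A : V -> dual V) : Prop :=
  forall u v, 0 <= (A u - A v) (posV (u - v)) /\
    ((A u - A v) (posV (u - v)) = 0 <-> posV (u - v) = 0).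

Definition admissible (A : V -> dual V) : Prop :=
  [/\ (forall t u, 0 < t -> A (t *: u) = t *: A u),
      (exists C : R, forall u v, dual_norm (A u - A v) <= C * `|u - v|),
      strongly_monotone A
    & T_monotone A].

(* Phi is only ever evaluated on Hp. *)
Definition increasing_on_cone (Phi : H -> H) : Prop :=
  (forall v, Hp v -> Hp (Phi v)) /\
  (forall v w, Hp v -> hle v w -> hle (Phi v) (Phi w)).

Definition extend (Phi : H -> H) (x : H) : H := Phi (pos x).

Definition Kset (psi : H) : set V := [set v | hle (G v) psi].

Definition solves_VI (A : V -> dual V) (f : dual V) (psi : H) (y : V) : Prop :=
  Kset psi y /\ forall v, Kset psi v -> 0 <= (A y - f) (v - y).

(* [VI_sol] and, below, [minsol] and [maxsol] pick the element that is unique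
   when it exists, and default to 0. *)
Definition VI_sol (A : V -> dual V) (f : dual V) (psi : H) : V :=
  xget 0 (solves_VI A f psi).

Definition QVI_sol (A : V -> dual V) (Phi : H -> H) (ybar : V) (f : dual V) : set V :=
  [set y | order_itv 0 (G ybar) (G y) /\ VI_sol A f (extend Phi (G y)) = y].

Definition smallest (E : set V) (y : V) : Prop :=
  E y /\ forall z, E z -> hle (G y) (G z).

Definition largest (E : set V) (y : V) : Prop :=
  E y /\ forall z, E z -> hle (G z) (G y).

Definition minsol (A : V -> dual V) (Phi : H -> H) (ybar : V) (f : dual V) : V :=
  xget 0 (smallest (QVI_sol A Phi ybar f)).

Definition maxsol (A : V -> dual V) (Phi : H -> H) (ybar : V) (f : dual V) : V :=
  xget 0 (largest (QVI_sol A Phi ybar f)).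

End order.

Definition outer_restriction (R : realType) (T : pointedType)
    (mu : {outer_measure set T -> \bar R}) :
    {measure set (caratheodory_type mu) -> \bar R} :=
  (mu : set (caratheodory_type mu) -> \bar R).

Section lebesgue.
Context (R : realType) (N : nat).
Local Open Scope ereal_scope.

(* [None] is the empty set: for N = 0, covers of set0 need an empty box. *)
Definition box (b : option ('rV[R]_N * 'rV[R]_N)) : set 'rV[R]_N :=
  if b is Some (l, r) then [set x | forall i, (l 0%R i <= x 0%R i <= r 0%R i)%R]
  else set0.

Definition box_vol (b : option ('rV[R]_N * 'rV[R]_N)) : \bar R :=
  if b is Some (l, r) then (\prod_(i < N) Num.max 0 (r 0 i - l 0 i))%R%:E else 0.

Definition lebesgue_outer (X : set 'rV[R]_N) : \bar R :=
  ereal_inf [set \sum_(k <oo) box_vol (B k) | B in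
    [set B : nat -> option ('rV[R]_N * 'rV[R]_N) | X `<=` \bigcup_k box (B k)]].

Lemma box_vol_ge0 b : 0 <= box_vol b.
Proof.
case: b => [[l r]|]//=; rewrite lee_fin prodr_ge0// => i _.
by rewrite le_max lexx.
Qed.

Lemma lebesgue_outer_ge0 X : 0 <= lebesgue_outer X.
Proof.
apply: le_ereal_inf_tmp => _ [B _ <-].
by apply: nneseries_ge0 => *; exact: box_vol_ge0.
Qed.

Lemma lebesgue_outer0 : lebesgue_outer set0 = 0.
Proof.
apply/eqP; rewrite eq_le lebesgue_outer_ge0 andbT.
apply: ereal_inf_lbound; exists (fun=> None) => //.
by rewrite eseries0.
Qed.

Lemma le_lebesgue_outer : {homo lebesgue_outer : A B / A `<=` B >-> A <= B}.
Proof.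
move=> A B AB; apply: le_ereal_inf => _ [C BC <-]; exists C => //.
exact: subset_trans BC.
Qed.

Lemma lebesgue_outer_sigma_subadditive : sigma_subadditive lebesgue_outer.
Proof.
move=> A; have [[i ioo]|] := pselect (exists i, lebesgue_outer (A i) = +oo).
  rewrite (eseries_pinfty _ _ ioo) ?leey// => n _.
  by rewrite -ltNye (lt_le_trans _ (lebesgue_outer_ge0 _)).
rewrite -forallNE => Aoo.
suff add2e (e : {posnum R}) : lebesgue_outer (\bigcup_n A n) <=
    \sum_(i <oo) lebesgue_outer (A i) + e%:num%:E.
  by apply/lee_addgt0Pr => _/posnumP[].
rewrite (le_trans _ (epsilon_trick _ _ _))//; last first.
  by move=> n; exact: lebesgue_outer_ge0.
pose P n (B : nat -> option ('rV[R]_N * 'rV[R]_N)) :=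
  A n `<=` \bigcup_k box (B k) /\
  \sum_(k <oo) box_vol (B k) <=
    lebesgue_outer (A n) + (e%:num / (2 ^ n.+1)%:R)%:E.
have [F PF] : {F & forall n, P n (F n)}.
  apply: (@choice _ _ P) => n; rewrite /P /lebesgue_outer.
  set Y := (X in ereal_inf X); move infY : (ereal_inf Y) => iY.
  case: iY infY => [r Yr|Yoo|Yoo].
  - have en1 : (0 < e%:num / (2 ^ n.+1)%:R)%R by [].
    have /(lb_ereal_inf_adherent en1) : ereal_inf Y \is a fin_num by rewrite Yr.
    move=> [x [B AnB volBx] xY].
    by exists B; split => //; rewrite volBx -Yr; exact/ltW.
  - by have := Aoo n; rewrite /lebesgue_outer Yoo.
  - suff : lbound Y 0 by move/le_ereal_inf_tmp; rewrite Yoo.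
    by move=> /= _ [B AnB <-]; apply: nneseries_ge0 => *; exact: box_vol_ge0.
have volF_ge0 x : 0 <= (box_vol \o uncurry F) x by exact: box_vol_ge0.
apply: (@le_trans _ _ (\esum_(i in setT) (box_vol \o uncurry F) i)).
  rewrite /lebesgue_outer; apply: ereal_inf_lbound => /=.
  have /card_esym/ppcard_eqP[f] := card_nat2.
  exists (uncurry F \o f).
    apply: (@subset_trans _ (\bigcup_n \bigcup_k box (F n k))) => [t [i _]|].
      by move=> /(PF i).1 -[j _ ?]; exists i => //; exists j.
    move=> t [i _ [j _ Bijt]]; exists (f^-1%FUN (i, j)) => //=.
    by rewrite invK ?inE.
  rewrite -(esum_pred_image (box_vol \o uncurry F) _ xpredT) ?[fun=> _]set_true//.
  by rewrite image_eq.
rewrite (_ : esum _ _ = \sum_(i <oo) \sum_(j <oo ) box_vol (F i j)); last first.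
  pose J : nat -> set (nat * nat) := fun i => [set (i, j) | j in setT].
  rewrite (_ : setT = \bigcup_k J k); last first.
    by rewrite predeqE => -[a b]; split => // _; exists a => //; exists b.
  rewrite esum_bigcupT /=; last 2 first.
    - apply/trivIsetP => i j _ _ ij.
      rewrite predeqE => -[n m] /=; split => //= -[] [_] _ [<-{n} _].
      by move=> [m' _] [] /esym/eqP; rewrite (negbTE ij).
    - by move=> /= [n m]; exact: box_vol_ge0.
  rewrite -(image_id [set: nat]) -fun_true esum_pred_image//; last first.
    by move=> n _; apply: esum_ge0 => *; exact: box_vol_ge0.
  apply: eq_eseriesr => /= j _.
  rewrite -(esum_pred_image (box_vol \o uncurry F) (pair j) predT)/=; last 2 first.
    by move=> ? _; exact: box_vol_ge0.
    by move=> ? ? _ _; exact: (@can_inj _ _ _ snd).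
  by congr esum; rewrite predeqE => -[a b]; split; move=> [i _ <-]; exists i.
apply: lee_lim.
- apply: is_cvg_nneseries => n *.
  by apply: nneseries_ge0 => m *; exact: (volF_ge0 (n, m)).
- by apply: is_cvg_nneseries => n *; apply: adde_ge0 => //; exact: lebesgue_outer_ge0.
- by near=> n; apply: lee_sum => i _; exact: (PF i).2.
Unshelve. all: by end_near. Qed.

HB.instance Definition _ := isOuterMeasure.Build R 'rV[R]_N lebesgue_outer
  lebesgue_outer0 lebesgue_outer_ge0 le_lebesgue_outer
  lebesgue_outer_sigma_subadditive.

Definition lebesgue_om : {outer_measure set 'rV[R]_N -> \bar R} := lebesgue_outer.

(* R^N with the Lebesgue (not only Borel) sigma-algebra, so that measurability
   does not depend on the choice of representatives *)
Definition RN := caratheodory_type lebesgue_om.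
HB.instance Definition _ := Measurable.on RN.

Definition lebesgueN : {measure set RN -> \bar R} := outer_restriction lebesgue_om.

End lebesgue.

Section function_space.
Context (R : realType) (N : nat) (Omega : set 'rV[R]_N).

Definition ae_on (P : RN R N -> Prop) : Prop :=
  {ae @lebesgueN R N, forall x, Omega x -> P x}.

Definition Linf_norm (z : RN R N -> R) : \bar R :=
  Lnorm (@lebesgueN R N) +oo%E (EFin \o (z \_ Omega)).

Definition Linf_fun (z : RN R N -> R) : Prop :=
  measurable_fun (Omega : set (RN R N)) z /\ (Linf_norm z < +oo)%E.

Context (V H : hilbertType R) (G : gelfand V H) (Hp : set H).
(* [fn h] is a representative of h, which is a class of almost everywhere
   equal functions on Omega; v in V is represented by [fn (G v)]. *)
Context (fn : H -> RN R N -> R).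

Definition in_Linf (h : H) : Prop := Linf_fun (fn h).

Definition in_Linf_nu (nu : R) (h : H) : Prop :=
  in_Linf h /\ ae_on (fun x => nu <= fn h x).

Definition cvg_Linf (u : nat -> H) (l : H) : Prop :=
  [/\ forall n, in_Linf (u n), in_Linf l
    & Linf_norm (fn (u n - l)) @[n --> \oo] --> 0%E].

Record function_space : Prop := FunctionSpace {
  fn_add : forall g h, ae_on (fun x => fn (g + h) x = fn g x + fn h x);
  fn_scale : forall a h, ae_on (fun x => fn (a *: h) x = a * fn h x);
  fn_inj : forall h, ae_on (fun x => fn h x = 0) -> h = 0;
  Linf_sub : forall z, Linf_fun z -> exists h, ae_on (fun x => fn h x = z x);
  Linf_continuous : exists C : R, forall h, in_Linf h ->
    (`|h|%:E <= C%:E * Linf_norm (fn h))%E;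
  Linf_dense : dense [set h | in_Linf h];
  (* the order induced on L^oo by that of H is the a.e. pointwise one *)
  Linf_order : forall h, in_Linf h -> (Hp h <-> ae_on (fun x => 0 <= fn h x)) }.

Definition assumption_a (nu : R) (Phi : H -> H) : Prop :=
  forall (v : nat -> V) (l : V), weak_cvg v l ->
    [/\ forall n, in_Linf_nu nu (extend Hp Phi (G (v n))),
        in_Linf_nu nu (extend Hp Phi (G l))
      & cvg_Linf (fun n => extend Hp Phi (G (v n))) (extend Hp Phi (G l))] \/
    cvg_V G (fun n => extend Hp Phi (G (v n))) (extend Hp Phi (G l)).

Definition assumption_b (Phi : H -> H) : Prop :=
  (forall (v : nat -> V) (l : V), weak_cvg v l ->
     extend Hp Phi (G (v n)) @[n --> \oo] --> extend Hp Phi (G l)) /\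
  exists Q : {linear V -> dual V},
    [/\ exists C : R, forall v, dual_norm (Q v) <= C * `|v|,
        strongly_monotone Q,
        (forall v, Q (negV G Hp v) (posV G Hp v) <= 0)
      & forall v, Hp (G v) ->
          exists w, G w = Phi (G v) /\ dle G Hp 0 (Q w)].

Definition assumption_A (nu : R) (Phi : H -> H) : Prop :=
  assumption_a nu Phi \/ assumption_b Phi.

End function_space.

(* Main.v *)
Require Import Defs.
From HB Require Import structures.
From mathcomp Require Import all_boot all_order all_algebra.
From mathcomp Require Import all_classical all_reals all_analysis.
From mathcomp Require Import ess_sup_inf measurable_realfun ring lra.
Import Order.TTheory GRing.Theory Num.Theory.
Import numFieldNormedType.Exports.
Local Open Scope classical_set_scope.
Local Open Scope ring_scope.

(* The solution map [f |-> X f] (minimal or maximal) is monotone and, since A is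
   homogeneous and [Phi (lambda y) <= lambda Phi y] for [lambda > 1], satisfies
   [X f <= lambda X g] as soon as [f <= lambda g]: [lambda * minsol g] is a
   supersolution for f, and [maxsol f / lambda] a subsolution for g. As
   [f_n >= nu > 0] converges in L^oo, for every [lambda > 1] eventually
   [f_n <= lambda f*] and [f* <= lambda f_n], so that X f_n is squeezed between
   [X f* / lambda] and [lambda X f*]; hence convergence in H. Coercivity bounds
   X f_n in V, which upgrades this to weak convergence in V.
   Extremal solutions exist by Tarski's theorem, because norm-maximizing
   sequences make order bounded sets of H closed under suprema have least upper
   bounds. *)

Set Implicit Arguments.
Unset Strict Implicit.
Unset Printing Implicit Defensive.

(** * Continuous linear functionals and their norm *)

Section dual_calculus.
Context (R : realType) (V : normedModType R).
Implicit Types f g : dual V.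

Lemma dual_add f g v : (f + g) v = f v + g v :> R. Proof. by []. Qed.

Lemma dual_opp f v : (- f) v = - f v :> R. Proof. by []. Qed.

Lemma dual_scale a f v : (a *: f) v = a * f v :> R. Proof. by []. Qed.

Lemma dual_zero v : (0 : dual V) v = 0 :> R. Proof. by []. Qed.

Lemma dualD f u v : f (u + v) = f u + f v :> R.
Proof. by have := dual_linear f 1 u v; rewrite !scale1r. Qed.

Lemma dual0 f : f 0 = 0 :> R.
Proof. by have := dualD f 0 0; rewrite addr0 => ?; lra. Qed.

Lemma dualZ f a v : f (a *: v) = a * f v :> R.
Proof. by have := dual_linear f a v 0; rewrite !addr0 dual0 addr0. Qed.

Lemma dualN f v : f (- v) = - f v :> R.
Proof. by rewrite -scaleN1r dualZ mulN1r. Qed.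

Lemma dual_bounded f : exists2 B : R, 0 <= B & forall v, `|f v| <= B * `|v|.
Proof.
pose g : {linear V -> R^o} :=
  HB.pack (f : V -> R^o) (GRing.isLinear.Build _ _ _ _ _ (dual_linear f)).
have /linear_boundedP/pinfty_ex_gt0[B B0 gB] : bounded_near g (nbhs (0 : V)).
  exact/linear_bounded_continuous/(@dual_continuous _ _ f).
by exists B => //; exact: ltW.
Qed.

(** The supremum in [dual_norm] is taken in R, so it is informative only for a bounded set;
    [dual_bounded] supplies the bound. *)
Lemma le_dual_norm f v : `|f v| <= dual_norm f * `|v|.
Proof.
have [B B0 fB] := dual_bounded f.
have [->|v0] := eqVneq v 0; first by rewrite dual0 !normr0 mulr0.
have nv : 0 < `|v| by rewrite normr_gt0.
rewrite -ler_pdivrMr//; apply: ub_le_sup => /=.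
  exists B => _ [w /= w1 <-]; apply: le_trans (fB w) _.
  by rewrite -[leRHS]mulr1 ler_wpM2l.
exists (`|v|^-1 *: v).
  by rewrite /= normrZ gtr0_norm ?invr_gt0// mulVf ?gt_eqF.
by rewrite dualZ normrM gtr0_norm ?invr_gt0// mulrC.
Qed.

End dual_calculus.

(** * Convergence and quadratic minimization in Hilbert spaces *)

Section hilbert.
Context (R : realType) (H : hilbertType R).
Implicit Types x y z u v : H.

Lemma dotNl x y : dot (- x) y = - dot x y.
Proof. by rewrite -scaleN1r dotZl mulN1r. Qed.

Lemma dotNr x y : dot x (- y) = - dot x y.
Proof. by rewrite dotC dotNl dotC. Qed.

Lemma dot0l x : dot 0 x = 0.
Proof. by rewrite -(scale0r x) dotZl mul0r. Qed.

Lemma dot0r x : dot x 0 = 0.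
Proof. by rewrite dotC dot0l. Qed.

Definition dotE :=
  (@dotDl R H, @dotDr R H, @dotZl R H, @dotZr R H, dotNl, dotNr).

Lemma dot_eq0 x : dot x x = 0 -> x = 0.
Proof. by rewrite dot_norm => /eqP; rewrite sqrf_eq0 normr_eq0 => /eqP. Qed.

Lemma normr_dot x y : `|dot x y| <= `|x| * `|y|.
Proof. by rewrite ler_norml dot_le andbT lerNl -dotNl -(normrN x) dot_le. Qed.

Lemma cvg_of_sqr_le (u : nat -> H) l (C : R) :
  (forall n, `|u n - l| ^+ 2 <= C * n.+1%:R^-1) -> u n @[n --> \oo] --> l.
Proof.
move=> uC; apply/cvgrPdist_lt => e e0.
have C0 : 0 < `|C| + 1 by rewrite ltr_wpDl.
near=> n.
rewrite distrC -(ltr_pXn2r (_ : 0 < 2)%N) ?nnegrE//; last exact: ltW.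
apply: le_lt_trans (uC n) _.
apply: (@le_lt_trans _ _ ((`|C| + 1) * n.+1%:R^-1)).
  by rewrite ler_wpM2r// (le_trans (ler_norm _))// lerDl.
rewrite -ltr_pdivlMl// mulrC.
by near: n; apply: near_infty_natSinv_lt (PosNum (divr_gt0 (exprn_gt0 2 e0) C0)).
Unshelve. all: by end_near. Qed.

(** Cauchy criterion in the form that the parallelogram identity delivers for minimizing and
    maximizing sequences. *)
Lemma cvg_of_sqr_dist_le (u : nat -> H) (C : R) :
  (forall m n, `|u m - u n| ^+ 2 <= C * (m.+1%:R^-1 + n.+1%:R^-1)) ->
  exists l : H, u n @[n --> \oo] --> l.
Proof.
move=> uC; suff ul : cvgn u by exists (limn u).
apply/cauchy_cvgP/cauchy_ballP => e e0; near_simpl.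
have C0 : 0 < `|C| + 1 by rewrite ltr_wpDl.
have d0 : 0 < e ^+ 2 / (2 * (`|C| + 1)) by rewrite divr_gt0 ?exprn_gt0// mulr_gt0.
near=> m n => /=; rewrite -ball_normE /=.
rewrite -(ltr_pXn2r (_ : 0 < 2)%N) ?nnegrE//; last exact: ltW.
apply: le_lt_trans (uC _ _) _.
have mn : 0 <= m.+1%:R^-1 + n.+1%:R^-1 :> R by rewrite addr_ge0.
apply: (@le_lt_trans _ _ ((`|C| + 1) * (m.+1%:R^-1 + n.+1%:R^-1))).
  by rewrite ler_wpM2r// (le_trans (ler_norm _))// lerDl.
rewrite -ltr_pdivlMl// (_ : _ * _ = e ^+ 2 / (2 * (`|C| + 1)) +
   e ^+ 2 / (2 * (`|C| + 1))); last by field; rewrite gt_eqF.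
apply: ltrD.
  by near: m; exact: near_infty_natSinv_lt (PosNum d0).
by near: n; exact: near_infty_natSinv_lt (PosNum d0).
Unshelve. all: by end_near. Qed.

Lemma cvg_dotr (u : nat -> H) l y :
  u n @[n --> \oo] --> l -> dot (u n) y @[n --> \oo] --> dot l y.
Proof.
move=> ul; apply/cvgrPdist_le => e e0.
have y0 : 0 < `|y| + 1 by rewrite ltr_wpDl.
near=> n; rewrite -dotNl -dotDl (le_trans (normr_dot _ _))//.
apply: (@le_trans _ _ (`|l - u n| * (`|y| + 1))); first by rewrite ler_wpM2l// lerDl.
rewrite -ler_pdivlMr//.
by near: n; move/cvgrPdist_le: ul; apply; rewrite divr_gt0.
Unshelve. all: by end_near. Qed.

Lemma closed_cvg_seq (K : set H) (u : nat -> H) l :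
  closed K -> (forall n, K (u n)) -> u n @[n --> \oo] --> l -> K l.
Proof.
move=> Kcl Ku ul; apply: (@closed_cvg _ _ \oo eventually_filter u K) ul => //.
exact: nearW.
Qed.

(* The minimizer of [|v|^2 + 2 l v] over K, through its optimality condition:
   this covers the projection onto K, the Riesz theorem and linear variational
   inequalities. *)
Lemma exists_minimizer (K : set H) (l : dual H) :
  closed K -> K !=set0 ->
  (forall t x y, 0 <= t <= 1 -> K x -> K y -> K (t *: x + (1 - t) *: y)) ->
  exists2 p, K p & forall v, K v -> 0 <= dot p (v - p) + l (v - p).
Proof.
move=> Kcl [k0 Kk0] Kcv.
pose J v : R := dot v v + 2 * l v.
have [B B0 lB] := dual_bounded l.
(* Completing the square: [J v >= (|v| - B)^2 - B^2]. *)
have JB v : - B ^+ 2 <= J v.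
  have := lB v; rewrite ler_norml => /andP[h _].
  have := sqr_ge0 (`|v| - B).
  by rewrite /J dot_norm !expr2; lra.
pose E := [set J v | v in K].
have E0 : has_inf E.
  split; first by exists (J k0), k0.
  by exists (- B ^+ 2) => _ [v _ <-].
have dJ v : K v -> inf E <= J v.
  by move=> Kv; apply: ge_inf; [case: E0 | exists v].
have /choice[u uP] : forall n : nat, exists v, K v /\ J v < inf E + n.+1%:R^-1.
  move=> n; have [//|_ [v Kv <-] vE] := @inf_adherent R E n.+1%:R^-1 _ E0.
  by exists v.
have half : 0 <= (2^-1 : R) <= 1 by lra.
(* Parallelogram identity: [|x - y|^2] is [2 J x + 2 J y] minus four times [J] at the midpoint,
   where [J] is at least [inf E]; the linear parts cancel. *)
have par x y : K x -> K y ->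
    `|x - y| ^+ 2 <= 2 * (J x - inf E) + 2 * (J y - inf E).
  move=> Kx Ky; have := dJ _ (Kcv _ _ _ half Kx Ky).
  rewrite -dot_norm /J !(dualD, dualZ) !dotE (dotC y x).
  by rewrite (_ : 1 - 2^-1 = 2^-1 :> R); lra.
have [p up] : exists p : H, u n @[n --> \oo] --> p.
  apply: (@cvg_of_sqr_dist_le _ 2) => m n.
  have [Km Jm] := uP m; have [Kn Jn] := uP n.
  move: (par _ _ Km Kn) Jm Jn.
  by move: (m.+1%:R^-1) (n.+1%:R^-1) => a b; lra.
have Kp : K p by apply: (closed_cvg_seq Kcl _ up) => n; case: (uP n).
exists p => // v Kv.
have Jp : J p <= inf E.
  have : J (u n) @[n --> \oo] --> J p.
    rewrite /J; under eq_fun do rewrite dot_norm expr2.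
    rewrite dot_norm expr2; apply: cvgD; first by apply: cvgM; exact: cvg_norm.
    apply: cvgMr; exact: (cvg_comp _ _ up (@dual_continuous _ _ l p)).
  move=> /cvgrPdist_lt Jc; rewrite leNgt; apply/negP => lt.
  pose d := (J p - inf E) / 2.
  have d0 : 0 < d by rewrite /d; lra.
  have [n [/=]] := filter_ex (filterI (Jc _ d0) (near_infty_natSinv_lt (PosNum d0))).
  rewrite ltr_norml => /andP[_ h1] h2; have [_ h3] := uP n.
  by move: h1 h2 h3; rewrite /d /=; move: (n.+1%:R^-1) => a; lra.
set a := _ + _; set q := dot (v - p) (v - p).
have q0 : 0 <= q by rewrite /q dot_norm sqr_ge0.
(* Along the segment from [p] to [v], this quadratic in [t] is [J (p + t (v - p)) - J p]. *)
have key t : 0 <= t <= 1 -> 0 <= 2 * t * a + t ^+ 2 * q.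
  move=> t01; have := dJ _ (Kcv _ _ _ t01 Kv Kp).
  rewrite (_ : t *: v + (1 - t) *: p = p + t *: (v - p)); last first.
    by rewrite scalerBl scale1r scalerBr addrCA addrA.
  move=> h; have := le_trans Jp h.
  rewrite /J /a /q; move: (v - p) => w.
  by rewrite !(dualD, dualZ) !dotE (dotC w p) expr2; lra.
(* For a negative slope [a] the quadratic is negative at [t = 1] if [q <= -a], and otherwise at its
   minimizer [t = -a/q], with value [-a^2/q]. *)
rewrite leNgt; apply/negP => a0.
have [qa|qa] := leP q (- a).
  by have := key 1; rewrite expr1n; lra.
have q1 : 0 < q by lra.
have := key (- a / q); rewrite divr_ge0 ?ler_pdivrMr//=; [|lra..].
rewrite mul1r (ltW qa) => /(_ isT).
rewrite (_ : _ + _ = - (a ^+ 2 / q)); last by field; rewrite gt_eqF.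
by rewrite oppr_ge0 leNgt divr_gt0// exprn_even_gt0//= lt_eqF.
Qed.

End hilbert.

(** * Riesz representation *)

Section riesz.
Context (R : realType) (V : hilbertType R).

Lemma dot_linear (x : V) : linear (fun v : V => dot x v : R^o).
Proof. by move=> a u v; rewrite dotDr dotZr. Qed.

Lemma dot_dual_subproof (x : V) : (fun v : V => dot x v : R^o) \in @dual_pred R V.
Proof.
apply/asboolP; split; first exact: dot_linear.
move=> y; apply/cvgrPdist_lt => e e0.
have x0 : 0 < `|x| + 1 by rewrite ltr_wpDl.
have /cvgrPdist_lt /(_ (e / (`|x| + 1))) : v @[v --> y] --> y by exact: cvg_id.
rewrite divr_gt0// => /(_ isT); apply: filterS => z.
rewrite ltr_pdivlMr// => h; rewrite -dotNr -dotDr.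
apply: le_lt_trans h; rewrite (le_trans (normr_dot _ _))//.
by rewrite mulrC ler_wpM2l// lerDl.
Qed.

Definition dot_dual (x : V) : dual V := Dual (dot_dual_subproof x).

(** The minimizer [p] of [|v|^2 - 2 f v] over the whole space represents [f]: optimality tested at
    [p + v] and at [p - v] gives opposite inequalities. *)
Lemma riesz (f : dual V) : exists r : V, forall v, f v = dot r v.
Proof.
have [||//|p _ pP] := @exists_minimizer _ V setT (- f).
- exact: closedT.
- by exists 0.
exists p => v.
have h1 := pP (p + v) I; have h2 := pP (p - v) I.
move: h1 h2; rewrite !(addrC p) !addrK dotNr dualN !dual_opp.
by lra.
Qed.

End riesz.

(** * Variational inequalities for strongly monotone Lipschitz operators *)

Section lions_stampacchia.
Context (R : realType) (V : hilbertType R).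

(** Lions-Stampacchia argument: [P w] projects [w - rho (A w - f)] onto [K], functionals being read
    through Riesz. [P] is a contraction, and its fixed point satisfies the inequality. *)
Lemma variational_inequality (K : set V) (A : V -> dual V) (f : dual V) (c C : R) :
  closed K -> K !=set0 ->
  (forall t x y, 0 <= t <= 1 -> K x -> K y -> K (t *: x + (1 - t) *: y)) ->
  0 < c -> (forall u v, c * `|u - v| ^+ 2 <= (A u - A v) (u - v)) ->
  (forall u v, dual_norm (A u - A v) <= C * `|u - v|) ->
  exists2 y, K y & forall v, K v -> 0 <= (A y - f) (v - y).
Proof.
move=> Kcl K0 Kcv c0 Amon Alip.
pose L := `|C| + c.
have L0 : 0 < L by rewrite ltr_wpDl.
have CL : C <= L by rewrite (le_trans (ler_norm C))// lerDl ltW.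
have cL : c <= L by rewrite /L lerDr.
(* This [rho] minimizes [1 - 2 rho c + rho^2 L^2], which bounds the squared Lipschitz constant of
   [w - rho A w]; the minimum is [q2], nonnegative because [c <= L]. *)
pose rho := c / L ^+ 2.
have rho0 : 0 < rho by rewrite divr_gt0// exprn_gt0.
have /choice[P PP] : forall w, exists p, K p /\
    forall v, K v -> 0 <= dot p (v - p) + (rho *: (A w - f) - dot_dual w) (v - p).
  move=> w; have [p Kp pP] :=
    @exists_minimizer _ V K (rho *: (A w - f) - dot_dual w) Kcl K0 Kcv.
  by exists p.
pose q2 := 1 - (c / L) ^+ 2.
have q20 : 0 <= q2.
  by rewrite subr_ge0 expr_le1 ?divr_ge0 ?ler_pdivrMr ?mul1r// ltW.
have q21 : q2 < 1 by rewrite ltrBlDr ltrDl exprn_gt0// divr_gt0.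
have Plip w1 w2 : `|P w1 - P w2| <= Num.sqrt q2 * `|w1 - w2|.
  have [r rP] := riesz (A w1 - A w2).
  have r2 : dot r r <= L ^+ 2 * `|w1 - w2| ^+ 2.
    have [->|rn0] := eqVneq r 0; first by rewrite dot0l mulr_ge0 ?sqr_ge0.
    rewrite dot_norm -exprMn ler_pXn2r ?nnegrE//; last by rewrite mulr_ge0// ltW.
    have rp : 0 < `|r| by rewrite normr_gt0.
    rewrite -(ler_pM2r rp) -expr2 -dot_norm -rP.
    apply: le_trans (ler_norm _) _; apply: le_trans (le_dual_norm _ _) _.
    rewrite ler_wpM2r//; apply: le_trans (Alip _ _) _.
    by rewrite ler_wpM2r.
  have mon : c * `|w1 - w2| ^+ 2 <= dot r (w1 - w2) by rewrite -rP.
  pose z := w1 - w2 - rho *: r.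
  have z2 : dot z z <= q2 * `|w1 - w2| ^+ 2.
    rewrite /z; move: (w1 - w2) mon r2 => w mon r2.
    rewrite !dotE (dotC w r) dot_norm.
    apply: (@le_trans _ _ (`|w| ^+ 2 - 2 * (rho * (c * `|w| ^+ 2)) +
        rho ^+ 2 * (L ^+ 2 * `|w| ^+ 2))).
      have := ler_wpM2l (ltW rho0) mon.
      have := ler_wpM2l (sqr_ge0 rho) r2.
      by rewrite (expr2 rho); lra.
    rewrite le_eqVlt; apply/orP; left; apply/eqP.
    by rewrite /q2 /rho; field; rewrite gt_eqF.
  have [K1 P1] := PP w1; have [K2 P2] := PP w2.
  (* Each projection is tested with the other one, as for nonexpansiveness. *)
  have pz : `|P w1 - P w2| ^+ 2 <= dot z (P w1 - P w2).
    have := P2 _ K1; have := P1 _ K2; rewrite -(opprB (P w1) (P w2)).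
    move: (rP (P w1 - P w2)); rewrite -dot_norm /z !dualN dotNr.
    rewrite !(dual_add, dual_scale, dual_opp) /=.
    move=> h; rewrite [dot (P w1 - P w2) _]dotDl !(dotDl, dotNl, dotZl) -h.
    by lra.
  have [->|nz] := eqVneq (`|P w1 - P w2|) 0; first by rewrite mulr_ge0// sqrtr_ge0.
  have np : 0 < `|P w1 - P w2| by rewrite lt_neqAle eq_sym nz normr_ge0.
  have pz' : `|P w1 - P w2| <= `|z|.
    by rewrite -(ler_pM2r np) -expr2 (le_trans pz)// dot_le.
  apply: le_trans pz' _.
  rewrite -(ler_pXn2r (_ : 0 < 2)%N) ?nnegrE// ?mulr_ge0 ?sqrtr_ge0//.
  by rewrite exprMn sqr_sqrtr// -dot_norm.
have Psub : {homo P : x / [set: V] x >-> [set: V] x} by [].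
pose g : {fun [set: V] >-> [set: V]} :=
  HB.pack P (isFun.Build _ _ [set: V] [set: V] P Psub).
have [|||y _ yP] := @banach_fixed_point _ _ _ g.
- exists (NngNum (sqrtr_ge0 q2)); split => /=.
    by rewrite -[ltRHS]sqrtr1 ltr_sqrt.
  by move=> [x1 x2] _ /=; exact: Plip.
- exact: closedT.
- by exists 0.
have {yP} yP : y = P y := yP.
have [Ky yVI] := PP y; rewrite -yP in Ky yVI.
exists y => // v /yVI.
move: (A y - f) => h; rewrite !(dual_add, dual_opp, dual_scale) /= addrC subrK.
by rewrite pmulr_rge0.
Qed.

End lions_stampacchia.

(** * Order and lattice structure of a self-dual cone *)

Section self_dual_cone.
Context (R : realType) (H : hilbertType R) (Hp : set H).
Hypothesis oc : ordering_cone Hp.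
Implicit Types x y z : H.
Local Notation "x <=+ y" := (hle Hp x y) (at level 70).

Lemma cone_dual v : Hp v <-> forall y, Hp y -> 0 <= dot v y.
Proof. by case: oc. Qed.

Lemma cone_closed : closed Hp. Proof. by case: oc. Qed.

Lemma cone0 : Hp 0.
Proof. by apply/cone_dual => y _; rewrite dot0l. Qed.

Lemma coneD x y : Hp x -> Hp y -> Hp (x + y).
Proof.
move=> /cone_dual hx /cone_dual hy; apply/cone_dual => z Hz.
by rewrite dotDl addr_ge0 ?hx ?hy.
Qed.

Lemma coneZ t x : 0 <= t -> Hp x -> Hp (t *: x).
Proof. by case: oc => _ h _ _ _; exact: h. Qed.

Lemma hle_refl x : x <=+ x.
Proof. by rewrite /hle subrr; exact: cone0. Qed.

Lemma hle_trans y x z : x <=+ y -> y <=+ z -> x <=+ z.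
Proof. by move=> /coneD h /h; rewrite addrC subrKA. Qed.

Lemma hle_anti x y : x <=+ y -> y <=+ x -> x = y.
Proof.
rewrite /hle => /cone_dual h /h; rewrite -[x - y]opprB dotNr => h1.
apply/esym/subr0_eq/dot_eq0; apply/eqP; rewrite eq_le -oppr_ge0 h1.
by rewrite dot_norm sqr_ge0.
Qed.

Lemma hle0 x : 0 <=+ x <-> Hp x.
Proof. by rewrite /hle subr0. Qed.

Lemma hleN x y : x <=+ y -> - y <=+ - x.
Proof. by rewrite /hle opprK addrC. Qed.

Lemma hleB z x y : x <=+ y -> z - y <=+ z - x.
Proof. by rewrite /hle => h; rewrite opprB addrC addrA subrK. Qed.

Lemma hleZ t x y : 0 <= t -> x <=+ y -> t *: x <=+ t *: y.
Proof. by move=> t0; rewrite /hle -scalerBr; exact: coneZ. Qed.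

Lemma hle_cvgl (u : nat -> H) l y :
  (forall n, u n <=+ y) -> u n @[n --> \oo] --> l -> l <=+ y.
Proof.
move=> uy ul; apply: (closed_cvg_seq cone_closed uy).
by apply: cvgB => //; exact: cvg_cst.
Qed.

Lemma hle_cvgr (u : nat -> H) l y :
  (forall n, y <=+ u n) -> u n @[n --> \oo] --> l -> y <=+ l.
Proof.
move=> uy ul; apply: (closed_cvg_seq cone_closed uy).
by apply: cvgB => //; exact: cvg_cst.
Qed.

(** The point [p] given by the optimality condition is the only one of least distance to [x], so the
    choice in [pos] returns it. *)
Lemma posP x : Hp (pos Hp x) /\
  forall v, Hp v -> 0 <= dot (pos Hp x - x) (v - pos Hp x).
Proof.
have [|||p Hpp pP] := @exists_minimizer _ H Hp (- dot_dual x).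
- exact: cone_closed.
- by exists 0; exact: cone0.
- by case: oc => _ _ h _ _; exact: h.
have {}pP v : Hp v -> 0 <= dot (p - x) (v - p).
  by move=> /pP; rewrite dual_opp /= dotDl dotNl.
have dist v : `|x - v| ^+ 2 =
    `|x - p| ^+ 2 + 2 * dot (p - x) (v - p) + `|v - p| ^+ 2.
  rewrite (_ : x - v = (x - p) - (v - p)); last by rewrite opprB subrKA.
  rewrite -!dot_norm -(opprB x p) !dotNl.
  by move: (x - p) (v - p) => a b; rewrite !dotE (dotC b a); lra.
suff -> : pos Hp x = p by [].
have : Hp (pos Hp x) /\ forall q, Hp q -> `|x - pos Hp x| <= `|x - q|.
  apply: (@xgetPex _ 0
    [set p | Hp p /\ forall q, Hp q -> `|x - p| <= `|x - q|]).
  exists p; split=> // q Hq; rewrite -(ler_pXn2r (_ : 0 < 2)%N) ?nnegrE//.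
  by have := pP _ Hq; have := sqr_ge0 `|q - p|; rewrite (dist q); lra.
move=> [Hpos /(_ _ Hpp)].
rewrite -(ler_pXn2r (_ : 0 < 2)%N) ?nnegrE// (dist (pos Hp x)) => h.
apply/subr0_eq/dot_eq0; rewrite dot_norm; apply/eqP.
rewrite eq_le sqr_ge0 andbT.
by have := pP _ Hpos; move: h; lra.
Qed.

Lemma pos_cone x : Hp (pos Hp x). Proof. by case: (posP x). Qed.

(** Testing the projection with [pos x + y], for [y] in the cone, puts [pos x - x] in the dual cone,
    which is the cone itself. *)
Lemma pos_sub_cone x : Hp (pos Hp x - x).
Proof.
have [Hx h] := posP x; apply/cone_dual => y Hy.
by have := h _ (coneD Hx Hy); rewrite (addrC _ y) addrK.
Qed.

Lemma pos_id x : Hp x -> pos Hp x = x.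
Proof.
move=> Hx; have [_ /(_ _ Hx)] := posP x; rewrite -(opprB (pos Hp x)) dotNr => h.
apply/subr0_eq/dot_eq0/eqP; rewrite eq_le -oppr_ge0 h.
by rewrite dot_norm sqr_ge0.
Qed.

Lemma le_hsupl x y : x <=+ hsup Hp x y.
Proof. by rewrite /hle /hsup addrAC subrr add0r; exact: pos_cone. Qed.

Lemma le_hsupr x y : y <=+ hsup Hp x y.
Proof.
rewrite /hle /hsup addrAC -opprB addrC; exact: pos_sub_cone.
Qed.

Lemma hsup_le x y z : x <=+ z -> y <=+ z -> hsup Hp x y <=+ z.
Proof. by case: oc => _ _ _ _; exact. Qed.

(** The inner product of [y - x] and [x] is nonnegative. Thus a small gain in squared norm means a
    small move upwards. *)
Lemma sqr_dist_le x y : Hp x -> x <=+ y -> `|y - x| ^+ 2 <= `|y| ^+ 2 - `|x| ^+ 2.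
Proof.
rewrite /hle => Hx /cone_dual/(_ _ Hx); rewrite -!dot_norm !dotE (dotC x y).
by lra.
Qed.

(** The inner product of [b - x] and [b + x] is nonnegative and equals [|b|^2 - |x|^2]. *)
Lemma norm_le_of_hle x b : - b <=+ x -> x <=+ b -> `|x| <= `|b|.
Proof.
rewrite /hle opprK => h1 /cone_dual/(_ _ h1) h.
rewrite -(ler_pXn2r (_ : 0 < 2)%N) ?nnegrE//.
by move: h; rewrite -!dot_norm !dotE (dotC x b); lra.
Qed.

(** Joining any [x] of [E] to the nearly norm-maximal [e n] raises the squared norm by at most
    [1/(n+1)], so it moves [e n] little. Hence [e] is Cauchy and its limit lies above every [x]. *)
Lemma cone_lub (E : set H) b :
  E !=set0 -> (forall x y, E x -> E y -> E (hsup Hp x y)) ->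
  (forall x, E x -> Hp x /\ x <=+ b) ->
  exists l, (forall x, E x -> x <=+ l) /\
            forall z, (forall x, E x -> x <=+ z) -> l <=+ z.
Proof.
move=> [e0 Ee0] Esup Eb.
pose N := [set `|x| ^+ 2 | x in E].
have supN : has_sup N.
  split; first by exists (`|e0| ^+ 2), e0.
  exists (`|b| ^+ 2) => _ [x /Eb[Hx xb] <-].
  by have := sqr_dist_le Hx xb; have := sqr_ge0 `|b - x|; lra.
have NE x : E x -> `|x| ^+ 2 <= sup N.
  by move=> Ex; apply: ub_le_sup; [case: supN | exists x].
have /choice[e eP] : forall n : nat, exists x, E x /\ sup N - n.+1%:R^-1 < `|x| ^+ 2.
  move=> n; have [//|_ [v Ev <-] vE] := @sup_adherent R N n.+1%:R^-1 _ supN.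
  by exists v.
have dist n x : E x -> `|hsup Hp x (e n) - e n| ^+ 2 <= n.+1%:R^-1.
  move=> Ex; have [En nE] := eP n.
  apply: le_trans (sqr_dist_le (Eb _ En).1 (le_hsupr _ _)) _.
  by move: nE (NE _ (Esup _ _ Ex En)); move: (n.+1%:R^-1) => a; lra.
have [l el] : exists l : H, e n @[n --> \oo] --> l.
  apply: (@cvg_of_sqr_dist_le _ _ _ 2) => m n.
  have [Em mE] := eP m; have [En nE] := eP n.
  have := dist n _ Em; have := NE _ (Esup _ _ Em En).
  have := sqr_dist_le (Eb _ Em).1 (le_hsupl (e m) (e n)).
  have := sqr_ge0 `|(hsup Hp (e m) (e n) - e m) + (hsup Hp (e m) (e n) - e n)|.
  rewrite (_ : e m - e n =
    (hsup Hp (e m) (e n) - e n) - (hsup Hp (e m) (e n) - e m)); last first.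
    by rewrite opprB [RHS]addrC subrKA.
  move: mE; rewrite -!dot_norm.
  move: (hsup Hp (e m) (e n) - e n) (hsup Hp (e m) (e n) - e m) => u v.
  rewrite !dotE (dotC u v).
  by move: (n.+1%:R^-1) (m.+1%:R^-1) => a a'; lra.
exists l; split=> [x Ex|z zE]; last first.
  by apply: hle_cvgl el => n; apply: zE; case: (eP n).
have : hsup Hp x (e n) @[n --> \oo] --> l.
  rewrite -[X in _ --> X]add0r.
  rewrite (_ : (fun n => _) = (fun n => hsup Hp x (e n) - e n + e n)); last first.
    by apply/funext => n; rewrite subrK.
  apply: cvgD => //; apply: (@cvg_of_sqr_le _ _ _ _ 1) => n.
  by rewrite subr0 mul1r; exact: dist.
by apply: hle_cvgr => n; exact: le_hsupl.
Qed.

(** The supremum [s] of all [x <= T x] satisfies [s <= T s]; then [T s] is such an [x] too, whence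
    [T s <= s]. The last clause, stronger than maximality among fixed points, serves to compare
    solutions for different sources. *)
Lemma greatest_fixpoint (T : H -> H) b :
  (forall x y, order_itv Hp 0 b x -> order_itv Hp 0 b y ->
    x <=+ y -> T x <=+ T y) ->
  (forall x, order_itv Hp 0 b x -> order_itv Hp 0 b (T x)) ->
  Hp b ->
  exists s, [/\ order_itv Hp 0 b s, T s = s &
    forall x, order_itv Hp 0 b x -> x <=+ T x -> x <=+ s].
Proof.
move=> Tmon Titv Hb.
have itv0 : order_itv Hp 0 b 0 by split; [exact: hle_refl|exact/hle0].
pose E := [set x | order_itv Hp 0 b x /\ x <=+ T x].
have E0 : E 0 by split=> //; case: (Titv _ itv0).
have [||x [[/hle0]]//|s [sub slub]] := @cone_lub E b; first by exists 0.
  move=> x y [[x0 xb] xT] [[y0 yb] yT].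
  have itv : order_itv Hp 0 b (hsup Hp x y).
    by split; [exact: hle_trans (le_hsupl _ _)|exact: hsup_le].
  split=> //; apply: hsup_le.
    by apply: hle_trans xT _; apply: Tmon => //; exact: le_hsupl.
  by apply: hle_trans yT _; apply: Tmon => //; exact: le_hsupr.
have sitv : order_itv Hp 0 b s.
  by split; [exact: sub|apply: slub => x [[]]].
have sT : s <=+ T s.
  apply: slub => x Ex; have [xitv xT] := Ex; apply: hle_trans xT _.
  by apply: Tmon => //; exact: sub.
exists s; split=> // [|x xitv xT]; last by apply: sub; split.
apply: hle_anti => //; apply: sub; split; first exact: Titv.
by apply: Tmon => //; exact: Titv.
Qed.

Lemma itvB b x : order_itv Hp 0 b x -> order_itv Hp 0 b (b - x).
Proof. by move=> [x0 xb]; split; rewrite /hle ?subr0 ?opprB ?subrKC//; exact/hle0. Qed.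

(** The reflection [x |-> b - x] of the interval exchanges greatest and least fixed points. *)
Lemma least_fixpoint (T : H -> H) b :
  (forall x y, order_itv Hp 0 b x -> order_itv Hp 0 b y ->
    x <=+ y -> T x <=+ T y) ->
  (forall x, order_itv Hp 0 b x -> order_itv Hp 0 b (T x)) ->
  Hp b ->
  exists s, [/\ order_itv Hp 0 b s, T s = s &
    forall x, order_itv Hp 0 b x -> T x <=+ x -> s <=+ x].
Proof.
move=> Tmon Titv Hb.
have [x y xi yi xy|x xi|s [si sT sP]] :=
  @greatest_fixpoint (fun x => b - T (b - x)) b _ _ Hb.
- by apply/hleB/Tmon; [exact: itvB..|exact: hleB].
- by apply/itvB/Titv/itvB.
exists (b - s); split => [||x xi xT]; first exact: itvB.
  by rewrite -{2}sT subKr.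
rewrite -(subKr b x); apply: hleB; apply: sP; first exact: itvB.
by rewrite subKr; exact: hleB.
Qed.

End self_dual_cone.

(** * The obstacle problem: comparison, well-posedness, scaling *)

Section obstacle_problem.
Context (R : realType) (V H : hilbertType R) (G : gelfand V H) (Hp : set H).
Context (A : V -> dual V).
Hypotheses (oc : ordering_cone Hp) (ps : pos_stable G Hp).
Hypothesis adm : admissible G Hp A.
Implicit Types (f g : dual V) (psi : H) (u v y : V).
Local Notation "x <=+ y" := (hle Hp x y) (at level 70).
Local Notation S := (VI_sol G Hp A).

Lemma emb_posV v : G (posV G Hp v) = pos Hp (G v).
Proof. by apply: (@xgetPex _ 0 [set w | G w = pos Hp (G v)]); exact: ps.1. Qed.

Lemma dle_refl f : dle G Hp f f.
Proof. by move=> v _; rewrite subrr. Qed.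

(** With [w] the positive part of [u - v], the hypotheses give [(A u - A v) w <= (f - g) w <= 0], so
    the equality case of T-monotonicity forces [w = 0]. *)
Lemma comparison f g u v : dle G Hp f g ->
  (A u - f) (posV G Hp (u - v)) <= 0 -> 0 <= (A v - g) (posV G Hp (u - v)) ->
  G u <=+ G v.
Proof.
have [_ _ _ /(_ u v)[]] := adm; set w := posV G Hp (u - v) => Tge Teq fg hu hv.
have Gw : G w = pos Hp (G u - G v) by rewrite /w emb_posV linearB.
have w0 : w = 0.
  apply/Teq/eqP; rewrite eq_le Tge andbT.
  have := fg w; rewrite Gw => /(_ (pos_cone oc _)).
  move: hu hv; rewrite !dual_add !dual_opp.
  by lra.
have := pos_sub_cone oc (G u - G v).
by rewrite -Gw w0 linear0 sub0r opprB.
Qed.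

Lemma closed_Kset psi : closed (Kset G Hp psi).
Proof.
rewrite (_ : Kset G Hp psi = (fun v => psi - G v) @^-1` Hp)//.
have /continuous_closedP : continuous (fun v => psi - G v).
  move=> v; apply: cvgB; first exact: cvg_cst.
  exact: (@emb_continuous _ _ _ G).
by apply; exact: cone_closed oc.
Qed.

Lemma Kset_convex psi t u v : 0 <= t <= 1 ->
  Kset G Hp psi u -> Kset G Hp psi v -> Kset G Hp psi (t *: u + (1 - t) *: v).
Proof.
move=> /andP[t0 t1] Ku Kv; rewrite /Kset /= /hle linearD !linearZ/=.
rewrite (_ : psi - _ = t *: (psi - G u) + (1 - t) *: (psi - G v)).
  by apply: (coneD oc); apply: (coneZ oc) => //; rewrite subr_ge0.
rewrite !scalerBr addrACA -scalerDl -opprD.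
by rewrite (addrC t) subrK scale1r.
Qed.

Lemma VI_solP f psi : Hp psi -> solves_VI G Hp A f psi (S f psi).
Proof.
move=> Hpsi; have [_ [C AC] [c c0 Ac] _] := adm.
have [|y Ky yP] := @variational_inequality _ V (Kset G Hp psi) A f c C
  (@closed_Kset psi) _ (@Kset_convex psi) c0 Ac AC.
  by exists 0; rewrite /Kset /= linear0; exact/(hle0 Hp).
by apply: (@xgetPex _ 0 (solves_VI G Hp A f psi)); exists y.
Qed.

(** Two solutions tested against each other coincide by strong monotonicity. *)
Lemma VI_solE f psi y : solves_VI G Hp A f psi y -> S f psi = y.
Proof.
move=> [Ky yP]; apply: xget_unique; first by [].
move=> z [Kz zP]; have [_ _ [c c0 Ac] _] := adm.
have := yP _ Kz; have := zP _ Ky; have := Ac z y.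
rewrite -(opprB z y) dualN !(dual_add, dual_opp) => h1 h2 h3.
have : c * `|z - y| ^+ 2 <= 0 by lra.
rewrite pmulr_rle0// -dot_norm => h; apply/subr0_eq/dot_eq0/eqP.
by rewrite eq_le h dot_norm sqr_ge0.
Qed.

(** Homogeneity is available for positive factors; the factor 2 gives [A 0 = 2 A 0]. *)
Lemma operator0 : A 0 = 0.
Proof.
have [/(_ 2 0 (ltr0Sn R 1))] := adm; rewrite scaler0 => h _ _ _.
have : A 0 + 0 = A 0 + A 0 by rewrite addr0 {1}h scaler_nat.
by move/addrI.
Qed.

(* [u - (u - v)^+] is the infimum of u and v. *)
Lemma VI_sol_test_inf f psi v : Hp psi ->
  (A (S f psi) - f) (posV G Hp (S f psi - v)) <= 0.
Proof.
move=> Hpsi; have [Ky yP] := VI_solP f Hpsi.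
have := yP (S f psi - posV G Hp (S f psi - v)).
rewrite addrAC subrr add0r dualN oppr_ge0; apply.
rewrite /Kset /=; apply: (hle_trans oc) Ky.
rewrite /hle linearB opprB addrC subrK emb_posV; exact: pos_cone oc _.
Qed.

(* [v + (u - v)^+] is the supremum of u and v. *)
Lemma VI_sol_test_sup f psi u : Hp psi -> G u <=+ psi ->
  0 <= (A (S f psi) - f) (posV G Hp (u - S f psi)).
Proof.
move=> Hpsi upsi; have [Ky yP] := VI_solP f Hpsi.
have := yP (S f psi + posV G Hp (u - S f psi)).
rewrite addrAC subrr add0r; apply.
rewrite /Kset /= linearD emb_posV linearB; exact: (hsup_le oc Ky upsi).
Qed.

(** The solution for [psi] also lies below [phi], so it may enter the supremum test of the second
    problem. *)
Lemma VI_sol_le f g psi phi : Hp psi -> psi <=+ phi -> dle G Hp f g ->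
  G (S f psi) <=+ G (S g phi).
Proof.
move=> Hpsi psiphi fg; have Hphi : Hp phi.
  by apply/(hle0 Hp); apply: (hle_trans oc) psiphi; exact/(hle0 Hp).
apply: (comparison fg); first exact: VI_sol_test_inf.
apply: VI_sol_test_sup => //; apply: (hle_trans oc) psiphi.
by case: (VI_solP f Hpsi).
Qed.

Lemma VI_sol_ge0 f psi : Hp psi -> dle G Hp 0 f -> 0 <=+ G (S f psi).
Proof.
move=> Hpsi f0; rewrite -(linear0 G).
apply: (comparison f0); first by rewrite operator0 subrr.
by apply: VI_sol_test_sup; rewrite // linear0; exact/(hle0 Hp).
Qed.

Lemma VI_sol_le_unconstrained f ybar psi : Hp psi -> dle G Hp f (A ybar) ->
  G (S f psi) <=+ G ybar.
Proof.
move=> Hpsi fF; apply: (comparison fF); first exact: VI_sol_test_inf.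
by rewrite subrr.
Qed.

(** Scaling by [t] maps the test functions for [psi] onto those for [t *: psi], and [A] commutes
    with it. *)
Lemma VI_solZ t f psi : 0 < t -> Hp psi -> S (t *: f) (t *: psi) = t *: S f psi.
Proof.
move=> t0 Hpsi; have [Ky yP] := VI_solP f Hpsi; apply: VI_solE; split.
  by rewrite /Kset /= linearZ /=; apply: (hleZ oc) => //; exact: ltW.
move=> v Kv; have [At _ _ _] := adm; rewrite At// -scalerBr dual_scale.
apply: mulr_ge0; first exact: ltW.
have -> : v - t *: S f psi = t *: (t^-1 *: v - S f psi).
  by rewrite scalerBr scalerA mulfV ?gt_eqF// scale1r.
rewrite dualZ; apply: mulr_ge0; [exact: ltW|apply: yP].
have ti0 : 0 <= t^-1 by rewrite invr_ge0 ltW.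
have := hleZ oc ti0 Kv.
by rewrite /Kset /= scalerA mulVf ?gt_eqF// scale1r linearZ.
Qed.

(** Testing with 0 bounds [A y y] by the pairing of [h] with [y]. As the source lies in H, this
    pairing is controlled by H-norms, and [0 <= y <= b] gives [|G y| <= |b|]. *)
Lemma VI_sol_bound h psi b : Hp psi ->
  order_itv Hp 0 b (G (S (pivot G h) psi)) ->
  forall c, 0 < c -> (forall u v, c * `|u - v| ^+ 2 <= (A u - A v) (u - v)) ->
  `|S (pivot G h) psi| ^+ 2 <= c^-1 * (`|h| * `|b|).
Proof.
move=> Hpsi [y0 yb] c c0 Ac; have [Ky yP] := VI_solP (pivot G h) Hpsi.
set y := S _ _ in y0 yb Ky yP *.
rewrite -ler_pdivrMl ?invr_gt0// invrK.
have := Ac y 0; rewrite subr0 operator0 subr0 => /le_trans; apply.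
have := yP 0; rewrite sub0r dualN dual_add dual_opp => h0.
apply: (@le_trans _ _ (pivot G h y)).
  rewrite -subr_le0 -oppr_ge0; apply: h0.
  by rewrite /Kset /= linear0; exact/(hle0 Hp).
apply: le_trans (dot_le _ _) _; rewrite ler_wpM2l//.
apply: (norm_le_of_hle oc) => //; apply: (hle_trans oc) (y0).
rewrite /hle sub0r opprK; apply/(hle0 Hp).
exact: (hle_trans oc y0 yb).
Qed.

(** * Extremal solutions and their behaviour under scaling of the source *)

Section fixed_points.
Context (Phi : H -> H) (ybar : V).
Hypothesis incr : increasing_on_cone Hp Phi.
Hypothesis subhom : forall (lambda : R) (y : H), 1 < lambda -> Hp y ->
  Phi (lambda *: y) <=+ lambda *: Phi y.

Definition admissible_source f := dle G Hp 0 f /\ dle G Hp f (A ybar).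

Local Notation T f := (fun x => G (S f (extend Hp Phi x))).

Lemma extend_cone x : Hp (extend Hp Phi x).
Proof. by apply: incr.1; exact: pos_cone. Qed.

Lemma extend_id x : Hp x -> extend Hp Phi x = Phi x.
Proof. by move=> Hx; rewrite /extend pos_id. Qed.

Lemma QVI_map_le f g (x y : H) : dle G Hp f g -> Hp x -> x <=+ y -> T f x <=+ T g y.
Proof.
move=> fg Hx xy; apply: VI_sol_le => //; first exact: extend_cone.
rewrite !extend_id//; first exact: incr.2.
by apply/(hle0 Hp); apply: (hle_trans oc) xy; exact/(hle0 Hp).
Qed.

Lemma QVI_map_itv f x : admissible_source f -> order_itv Hp 0 (G ybar) (T f x).
Proof.
move=> [f0 fF]; split; first exact: VI_sol_ge0 (extend_cone _) f0.
exact: VI_sol_le_unconstrained (extend_cone _) fF.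
Qed.

Lemma ybar_cone f : admissible_source f -> Hp (G ybar).
Proof.
by move=> /(QVI_map_itv 0)[h1 h2]; apply/(hle0 Hp); exact: (hle_trans oc) h2.
Qed.

Lemma QVI_solE f y :
  QVI_sol G Hp A Phi ybar f y -> G (S f (extend Hp Phi (G y))) = G y.
Proof. by move=> [_ ->]. Qed.

(** Tarski's theorem is applied in H; a fixed point of [T f] is one of its values, hence comes from
    V. *)
Lemma QVI_sol_fixpoint f s : order_itv Hp 0 (G ybar) s -> T f s = s ->
  exists2 y, QVI_sol G Hp A Phi ybar f y & G y = s.
Proof.
by move=> si sT; exists (S f (extend Hp Phi s)) => //; split; rewrite sT.
Qed.

(** The minimal solution lies below every supersolution in the interval, not only below every
    solution. *)
Lemma minsolP f : admissible_source f ->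
  QVI_sol G Hp A Phi ybar f (minsol G Hp A Phi ybar f) /\
  forall x, order_itv Hp 0 (G ybar) x -> T f x <=+ x ->
    G (minsol G Hp A Phi ybar f) <=+ x.
Proof.
move=> af; have [x y [x0 _] _ xy|x _|s [si sT sP]] :=
    @least_fixpoint _ _ _ oc (T f) (G ybar) _ _ (ybar_cone af).
- by apply: QVI_map_le => //; [exact: dle_refl|exact/(hle0 Hp)].
- exact: QVI_map_itv.
have [y yQ ys] := QVI_sol_fixpoint si sT.
have ysm : Defs.smallest G Hp (QVI_sol G Hp A Phi ybar f) y.
  split=> // z zQ; rewrite ys; apply: sP; first by case: zQ.
  by rewrite (QVI_solE zQ); exact: hle_refl oc _.
rewrite (_ : minsol _ _ _ _ _ _ = y); first by rewrite ys; split.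
apply: xget_unique => // z [zQ zy]; apply: (@emb_injective _ _ _ G).
by apply: (hle_anti oc); [exact: zy|exact: ysm.2].
Qed.

Lemma maxsolP f : admissible_source f ->
  QVI_sol G Hp A Phi ybar f (maxsol G Hp A Phi ybar f) /\
  forall x, order_itv Hp 0 (G ybar) x -> x <=+ T f x ->
    x <=+ G (maxsol G Hp A Phi ybar f).
Proof.
move=> af; have [x y [x0 _] _ xy|x _|s [si sT sP]] :=
    @greatest_fixpoint _ _ _ oc (T f) (G ybar) _ _ (ybar_cone af).
- by apply: QVI_map_le => //; [exact: dle_refl|exact/(hle0 Hp)].
- exact: QVI_map_itv.
have [y yQ ys] := QVI_sol_fixpoint si sT.
have yla : largest G Hp (QVI_sol G Hp A Phi ybar f) y.
  split=> // z zQ; rewrite ys; apply: sP; first by case: zQ.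
  by rewrite (QVI_solE zQ); exact: hle_refl oc _.
rewrite (_ : maxsol _ _ _ _ _ _ = y); first by rewrite ys; split.
apply: xget_unique => // z [zQ zy]; apply: (@emb_injective _ _ _ G).
by apply: (hle_anti oc); [exact: yla.2|exact: zy].
Qed.

Lemma minsol_le_scale f g lambda :
  admissible_source f -> admissible_source g -> 1 < lambda ->
  dle G Hp f (lambda *: g) ->
  G (minsol G Hp A Phi ybar f) <=+ lambda *: G (minsol G Hp A Phi ybar g).
Proof.
move=> af ag l1 fg; have l0 : 0 < lambda by apply: lt_trans l1.
have [yQ _] := minsolP ag; set y := minsol _ _ _ _ _ g in yQ *.
have [[y0 yb] _] := yQ; have Hy : Hp (G y) by exact/(hle0 Hp).
have Hly : Hp (lambda *: G y) by apply: (coneZ oc) => //; exact: ltW.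
(* Monotonicity in source and obstacle compares [T f (lambda *: G y)] with the solution for the
   scaled data of [y], which is [lambda *: y]. *)
have Tly : T f (lambda *: G y) <=+ lambda *: G y.
  have {2}<- : G (S (lambda *: g) (lambda *: extend Hp Phi (G y))) = lambda *: G y.
    by rewrite VI_solZ//; [rewrite linearZ/= (QVI_solE yQ)|exact: extend_cone].
  apply: VI_sol_le => //; first exact: extend_cone.
  by rewrite !extend_id//; exact: subhom.
(* The infimum of [lambda *: y] and [ybar] is a supersolution in the interval. *)
pose z := - hsup Hp (- (lambda *: G y)) (- G ybar).
have zl : z <=+ lambda *: G y.
  by rewrite -[X in _ <=+ X]opprK; apply: hleN; exact: le_hsupl oc _ _.
have zb : z <=+ G ybar.
  by rewrite -[X in _ <=+ X]opprK; apply: hleN; exact: le_hsupr oc _ _.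
have zge x : x <=+ lambda *: G y -> x <=+ G ybar -> x <=+ z.
  move=> xl xb; rewrite -[X in X <=+ _]opprK; apply: hleN.
  by apply: (hsup_le oc); exact: hleN.
have z0 : 0 <=+ z.
  by apply: zge; apply/(hle0 Hp) => //; exact: ybar_cone af.
(* [T f z] lies below [T f (lambda *: G y)], hence below [lambda *: G y], and also below [ybar]; so
   it lies below their infimum [z]. *)
apply: (hle_trans oc) (zl); apply: (minsolP af).2 => //; apply: zge.
  apply: (hle_trans oc) Tly; apply: QVI_map_le zl; first exact: dle_refl.
  exact/(hle0 Hp).
by case: (QVI_map_itv z af).
Qed.

(** Dividing by [lambda > 1] keeps the subsolution in the interval, so no truncation by [ybar]
    occurs here. *)
Lemma maxsol_le_scale f g lambda :
  admissible_source f -> admissible_source g -> 1 < lambda ->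
  dle G Hp f (lambda *: g) ->
  G (maxsol G Hp A Phi ybar f) <=+ lambda *: G (maxsol G Hp A Phi ybar g).
Proof.
move=> af ag l1 fg; have l0 : 0 < lambda by apply: lt_trans l1.
have [yQ _] := maxsolP af; set y := maxsol _ _ _ _ _ f in yQ *.
have [[y0 yb] _] := yQ; have Hy : Hp (G y) by exact/(hle0 Hp).
pose x := lambda^-1 *: G y.
have yx : G y = lambda *: x by rewrite scalerA mulfV ?gt_eqF// scale1r.
have Hx : Hp x by apply: (coneZ oc) => //; rewrite invr_ge0 ltW.
have xy : x <=+ G y.
  rewrite yx /hle -[X in _ - X]scale1r -scalerBl; apply: (coneZ oc) => //.
  by rewrite subr_ge0 ltW.
have xT : x <=+ T g x.
  have -> : T g x = lambda^-1 *: (lambda *: T g x).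
    by rewrite scalerA mulVf ?gt_eqF// scale1r.
  apply: (hleZ oc); first by rewrite invr_ge0 ltW.
  rewrite -[X in X <=+ _](QVI_solE yQ) -linearZ/= -VI_solZ//; last exact: extend_cone.
  apply: VI_sol_le => //; first exact: extend_cone.
  by rewrite !extend_id// yx; exact: subhom.
rewrite yx; apply: (hleZ oc); first exact: ltW.
apply: (maxsolP ag).2 => //; split; first exact/(hle0 Hp).
exact: (hle_trans oc) yb.
Qed.

End fixed_points.

End obstacle_problem.

(** * Weak convergence in V from boundedness in V and convergence in H *)

Section weak_convergence.
Context (R : realType) (V H : hilbertType R) (G : gelfand V H).

Lemma weak_cvg_of_bounded (y : nat -> V) (l : V) (B : R) :
  (\forall n \near \oo, `|y n| <= B) ->
  G (y n) @[n --> \oo] --> G l -> weak_cvg y l.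
Proof.
move=> yB yl.
(* K contains the Riesz representatives of H, which are dense in V, and
   boundedness of y makes K closed. *)
pose K := [set r : V | dot (y n) r @[n --> \oo] --> dot l r].
have KP (h : H) r : (forall v, pivot G h v = dot r v) -> K r.
  move=> hr; have := cvg_dotr (y := h) yl; rewrite /K /=.
  under eq_fun do rewrite dotC -[dot h _]/(pivot G h _) hr dotC.
  by rewrite dotC -[dot h _]/(pivot G h _) hr dotC.
have Kcl : closed K.
  move=> r rK; apply/cvgrPdist_le => e e0.
  pose M := `|B| + `|l| + 1.
  have M0 : 0 < M by rewrite ltr_wpDl// addr_ge0.
  have eM0 : 0 < e / 2 / M by rewrite !divr_gt0.
  have [r' [Kr']] := rK _ (nbhsx_ballx r (e / 2 / M) eM0).
  rewrite -ball_normE /= => rr'.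
  have e20 : 0 < e / 2 by rewrite divr_gt0.
  (* The part along [r - r'] is small because [M] eventually bounds [|l - y n|]; the part along [r']
     tends to 0. *)
  near=> n; rewrite -dotNl -dotDl -(subrK r' r) dotDr.
  apply: le_trans (ler_normD _ _) _; rewrite [e]splitr; apply: lerD.
    apply: le_trans (normr_dot _ _) _.
    rewrite (@le_trans _ _ (M * (e / 2 / M)))//; last first.
      by rewrite mulrC divfK// gt_eqF.
    apply: ler_pM => //; last exact: ltW.
    apply: le_trans (ler_normB _ _) _; rewrite addrC.
    rewrite ler_wpDr// lerD2r; apply: le_trans (ler_norm B).
    by near: n.
  rewrite dotDl dotNl; near: n.
  by move/cvgrPdist_le: Kr'; apply.
have Kcv t u v : 0 <= t <= 1 -> K u -> K v -> K (t *: u + (1 - t) *: v).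
  move=> _ Ku Kv; rewrite /K /= dotDr !dotZr.
  under eq_fun do rewrite dotDr !dotZr.
  by apply: cvgD; [apply: cvgMr; exact: Ku|apply: cvgMr; exact: Kv].
have K0 : K 0.
  by rewrite /K /= dot0r; under eq_fun do rewrite dot0r; exact: cvg_cst.
move=> f; have [r rP] := riesz f.
have [p Kp pP] := @exists_minimizer _ V K (- dot_dual r) Kcl (ex_intro _ 0 K0) Kcv.
have {}pP v : K v -> 0 <= dot (p - r) (v - p).
  by move=> /pP; rewrite dual_opp /= dotDl dotNl.
suff rp : r = p.
  have -> : dual_fun f = (fun v => dot v p) by apply/funext => v; rewrite rP rp dotC.
  exact: Kp.
apply/esym/subr0_eq; apply: (@emb_injective _ _ _ G); rewrite linear0.
apply: dot_eq0.
(* Density through injectivity of the embedding: [p + s] lies in [K], and testing with it gives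
   [-|G (p - r)|^2 >= 0]. *)
have [s sP] := riesz (pivot G (- G (p - r))).
have : K (p + s).
  have Ks := KP _ _ sP; rewrite /K /= dotDr; under eq_fun do rewrite dotDr.
  exact: cvgD.
move=> /pP; rewrite (addrC p s) addrK dotC -sP /= dotNl oppr_ge0 => h.
by apply/eqP; rewrite eq_le h dot_norm sqr_ge0.
Unshelve. all: by end_near. Qed.

End weak_convergence.

(** * Convergence from two-sided ratio bounds *)

Section ratio.
Context (R : realType) (H : hilbertType R) (Hp : set H).
Hypothesis oc : ordering_cone Hp.

(** For [lambda = 1 + d] the ratio bounds place [x n - l] between [-d b] and [d b], so its norm is
    at most [d |b|]. *)
Lemma cvg_of_ratio (x : nat -> H) (l b : H) :
  (forall n, order_itv Hp 0 b (x n)) -> order_itv Hp 0 b l ->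
  (forall lambda, 1 < lambda -> \forall n \near \oo,
    hle Hp (x n) (lambda *: l) /\ hle Hp l (lambda *: x n)) ->
  x n @[n --> \oo] --> l.
Proof.
move=> xb [_ lb] ratio; apply/cvgrPdist_le => e e0.
have b0 : 0 < `|b| + 1 by rewrite ltr_wpDl.
pose d := e / (`|b| + 1); have d0 : 0 < d by rewrite divr_gt0.
have d1 : 1 < 1 + d by rewrite ltrDl.
near=> n.
have [xl lx] : hle Hp (x n) ((1 + d) *: l) /\ hle Hp l ((1 + d) *: x n).
  by near: n; exact: ratio.
apply: (@le_trans _ _ `|d *: b|); last first.
  rewrite normrZ gtr0_norm// /d mulrAC ler_pdivrMr//.
  by rewrite ler_pM2l// lerDl.
have key u v : hle Hp u ((1 + d) *: v) -> hle Hp v b -> hle Hp (u - v) (d *: b).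
  move=> uv vb; apply: (@hle_trans _ _ _ oc (d *: v)).
    move: uv; rewrite /hle scalerDl scale1r.
    by rewrite opprB addrCA addrA.
  by apply: hleZ => //; exact: ltW.
apply: (norm_le_of_hle oc); last by apply: key => //; case: (xb n).
by rewrite -(opprB (x n)); apply: hleN; exact: key.
Unshelve. all: by end_near. Qed.

End ratio.

(** * Essentially bounded functions and uniform convergence *)

Section essentially_bounded.
Context (R : realType) (N : nat) (Omega : set 'rV[R]_N).
Local Notation RN := (RN R N).
Local Notation mu := (@lebesgueN R N).

#[local] Instance lebesgueN_ae_filter : Filter (almost_everywhere mu) :=
  ae_filter_ringOfSetsType mu.

Lemma ae_on_and (P Q : RN -> Prop) :
  ae_on Omega P -> ae_on Omega Q -> ae_on Omega (fun x => P x /\ Q x).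
Proof. by rewrite /ae_on; apply: filterS2 => x p q Ox; split; [exact: p|exact: q]. Qed.

Lemma ae_onS (P Q : RN -> Prop) :
  (forall x, P x -> Q x) -> ae_on Omega P -> ae_on Omega Q.
Proof. by rewrite /ae_on => PQ; apply: filterS => x p Ox; exact/PQ/p. Qed.

Lemma Linf_norm_le (z : RN -> R) (e : R) : 0 <= e ->
  (Linf_norm Omega z <= e%:E)%E <-> ae_on Omega (fun x => `|z x| <= e).
Proof.
move=> e0; rewrite /Linf_norm unlock /=; case: ifPn => [_|mu0]; last first.
  (* If the whole space is null, the norm is 0 by convention and every property holds almost
     everywhere. *)
  split=> _; last by rewrite lee_fin.
  exists setT; split => //.
  by apply/eqP; rewrite eq_le measure_ge0 andbT leNgt.
split=> [/ess_supP|zae].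
  by apply: filterS => x + Ox; rewrite /= patchE (mem_set Ox) lee_fin.
apply/ess_supP; apply: (@filterS _ _ lebesgueN_ae_filter _ _ _ zae) => x zx /=.
rewrite lee_fin patchE; case: ifPn => [xO|_]; last by rewrite normr0.
by apply: zx; rewrite inE in xO.
Qed.

Lemma Linf_norm_fin (z : RN -> R) : (Linf_norm Omega z < +oo)%E ->
  exists2 e : R, 0 <= e & ae_on Omega (fun x => `|z x| <= e).
Proof.
have h : (0 <= Linf_norm Omega z)%E by exact: Lnorm_ge0.
move=> zoo; have zfin : Linf_norm Omega z \is a fin_num by rewrite ge0_fin_numE.
exists (fine (Linf_norm Omega z)); first exact: fine_ge0.
by apply/Linf_norm_le; rewrite ?fine_ge0// fineK.
Qed.

Context (V H : hilbertType R) (G : gelfand V H) (Hp : set H).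
Context (fn : H -> RN -> R).
Hypothesis fs : function_space Omega Hp fn.

Lemma fn_comb a g h :
  ae_on Omega (fun x => fn (a *: g - h) x = a * fn g x - fn h x).
Proof.
have := ae_on_and (fn_add fs (a *: g) (- h))
  (ae_on_and (fn_scale fs a g) (fn_scale fs (-1) h)).
apply: ae_onS => x [-> [->]]; rewrite scaleN1r mulN1r => ->.
by [].
Qed.

(** The representative of [a *: g - h] is the expected combination only almost everywhere;
    completeness of Lebesgue measure transfers measurability. *)
Lemma in_Linf_comb a g h :
  in_Linf Omega fn g -> in_Linf Omega fn h -> in_Linf Omega fn (a *: g - h).
Proof.
move=> [mg /Linf_norm_fin[eg eg0 gb]] [mh /Linf_norm_fin[eh eh0 hb]]; split.
  apply/measurable_EFinP.
  apply: (@ae_measurable_fun _ _ _ mu _ _ (EFin \o (fun x => a * fn g x - fn h x))).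
  - exact: measure_is_complete_caratheodory.
  - by apply: (@filterS _ _ lebesgueN_ae_filter _ _ _ (fn_comb a g h)) => x
      /[apply] /= ->.
  - apply/measurable_EFinP; apply: measurable_funB; last exact: mh.
    by apply: measurable_funM; [exact: measurable_cst|exact: mg].
apply: (@le_lt_trans _ _ (`|a| * eg + eh)%:E); last exact: ltry.
apply/Linf_norm_le; first by rewrite addr_ge0// mulr_ge0.
apply: ae_onS (ae_on_and (fn_comb a g h) (ae_on_and gb hb)) => x [-> [gx hx]].
apply: le_trans (ler_normB _ _) _; apply: lerD => //.
by rewrite normrM ler_wpM2l.
Qed.

Lemma cvg_Linf_ae (f : nat -> H) l e : cvg_Linf Omega fn f l -> 0 < e ->
  \forall n \near \oo, ae_on Omega (fun x => `|fn (f n - l) x| <= e).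
Proof.
move=> [_ _ fl] e0.
have nb : nbhs (0%E : \bar R) [set y | (y < e%:E)%E].
  apply: open_nbhs_nbhs; split; first exact: open_ereal_lt_ereal.
  by rewrite /= lte_fin.
have : \forall n \near \oo, (Linf_norm Omega (fn (f n - l)%R) < e%:E)%E := fl _ nb.
by apply: filterS => n /ltW/(Linf_norm_le _ (ltW e0)).
Qed.

Lemma cvg_Linf_cvg (f : nat -> H) l : cvg_Linf Omega fn f l -> f n @[n --> \oo] --> l.
Proof.
move=> fl; have [C CP] := Linf_continuous fs; have [fi li _] := fl.
apply/cvgrPdist_le => e e0.
have C0 : 0 < `|C| + 1 by rewrite ltr_wpDl.
have d0 : 0 < e / (`|C| + 1) by rewrite divr_gt0.
have := cvg_Linf_ae fl d0; apply: filterS => n /(Linf_norm_le _ (ltW d0)) fn_le.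
have fl_in : in_Linf Omega fn (f n - l).
  by rewrite -(scale1r (f n)); exact: in_Linf_comb.
rewrite distrC -lee_fin; apply: le_trans (CP _ fl_in) _.
apply: (@le_trans _ _ ((`|C| + 1)%:E * Linf_norm Omega (fn (f n - l)%R))%E).
  apply: lee_wpmul2r; first exact: Lnorm_ge0.
  by rewrite lee_fin (le_trans (ler_norm C))// lerDl.
apply: (@le_trans _ _ ((`|C| + 1)%:E * (e / (`|C| + 1))%:E)%E).
  by apply: lee_wpmul2l => //; rewrite lee_fin ltW.
by rewrite -EFinM lee_fin mulrC divfK// gt_eqF.
Qed.

(* The lower bound nu turns closeness in L^oo into a multiplicative estimate. *)
Lemma cvg_Linf_ratio (f : nat -> H) l nu : 0 < nu ->
  (forall n, in_Linf_nu Omega fn nu (f n)) -> cvg_Linf Omega fn f l ->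
  forall lambda, 1 < lambda -> \forall n \near \oo,
    hle Hp (f n) (lambda *: l) /\ hle Hp l (lambda *: f n).
Proof.
move=> nu0 fnu fl lambda l1; have [fi li _] := fl.
have l0 : 0 < lambda by apply: lt_trans l1.
(* The lower bound [nu] is applied to [f n]: [lambda l >= lambda f_n - lambda e >= f_n] requires
   [lambda e <= (lambda - 1) nu], whence the division by [lambda]. *)
pose e := (lambda - 1) * nu / lambda.
have e0 : 0 < e by rewrite divr_gt0// mulr_gt0// subr_gt0.
have le_nu : lambda * e = (lambda - 1) * nu by rewrite mulrC divfK// gt_eqF.
have e_le : e <= (lambda - 1) * nu.
  by rewrite -le_nu ler_peMl// ltW.
have := cvg_Linf_ae fl e0; apply: filterS => n fle.
have := ae_on_and fle (ae_on_and (fnu n).2 (fn_comb 1 (f n) l)).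
rewrite scale1r => {fle} fle; split; apply/(Linf_order fs).
- by apply: in_Linf_comb => //; exact: fi.
- apply: ae_onS (ae_on_and fle (fn_comb lambda l (f n))).
  move=> x [[+ [fx fE]] ->]; rewrite fE mul1r ler_norml => /andP[h1 h2].
  have := ler_wpM2l (ltW l0) h2; have : (lambda - 1) * nu <= (lambda - 1) * fn (f n) x.
    by rewrite ler_wpM2l// subr_ge0 ltW.
  by lra.
- by apply: in_Linf_comb => //; exact: fi.
- apply: ae_onS (ae_on_and fle (fn_comb lambda (f n) l)).
  move=> x [[+ [fx fE]] ->]; rewrite fE mul1r ler_norml => /andP[h1 h2].
  have : (lambda - 1) * nu <= (lambda - 1) * fn (f n) x.
    by rewrite ler_wpM2l// subr_ge0 ltW.
  by lra.
Qed.

End essentially_bounded.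

(** * Order relations between sources in the dual of V *)

Lemma dle_pivot (R : realType) (V H : hilbertType R) (G : gelfand V H)
    (Hp : set H) (g h : H) t :
  ordering_cone Hp -> hle Hp g (t *: h) -> dle G Hp (pivot G g) (t *: pivot G h).
Proof.
move=> oc gh v Hv; have /(cone_dual oc)/(_ _ Hv) := gh.
by rewrite dotDl dotNl dotZl.
Qed.

(** The order of the dual is tested on one [v] at a time, and each such pairing is continuous on H.
    This provides the extremal solutions for the limit source. *)
Lemma admissible_source_lim (R : realType) (V H : hilbertType R) (G : gelfand V H)
    (Hp : set H) (A : V -> dual V) (ybar : V) (f : nat -> H) (l : H) :
  f n @[n --> \oo] --> l ->
  (forall n, admissible_source G Hp A ybar (pivot G (f n))) ->
  admissible_source G Hp A ybar (pivot G l).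
Proof.
move=> fl fa; split=> v Hv.
- rewrite dual_add dual_opp dual_zero oppr0 addr0.
  apply: (cvgr_to_ge (cvg_dotr (y := G v) fl)); apply: nearW => n.
  by have := (fa n).1 v Hv; rewrite subr0.
- rewrite dual_add dual_opp subr_ge0.
  apply: (cvgr_to_le (cvg_dotr (y := G v) fl)); apply: nearW => n.
  by have := (fa n).2 v Hv; rewrite dual_add dual_opp subr_ge0.
Qed.

(** * Convergence of the solutions *)

Section convergence.
Context (R : realType) (V H : hilbertType R) (G : gelfand V H) (Hp : set H).
Context (A : V -> dual V) (Phi : H -> H) (ybar : V).
Hypotheses (oc : ordering_cone Hp) (ps : pos_stable G Hp).
Hypotheses (adm : admissible G Hp A) (incr : increasing_on_cone Hp Phi).

(** [X] stands for either extremal selection. The ratio bounds give convergence in H; coercivity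
    bounds the V-norms through the sources in H and [ybar]. *)
Lemma QVI_sol_cvg (f : nat -> H) (fstar : H) (X : H -> V) :
  f n @[n --> \oo] --> fstar ->
  (forall n, QVI_sol G Hp A Phi ybar (pivot G (f n)) (X (f n))) ->
  QVI_sol G Hp A Phi ybar (pivot G fstar) (X fstar) ->
  (forall lambda, 1 < lambda -> \forall n \near \oo,
    hle Hp (G (X (f n))) (lambda *: G (X fstar)) /\
    hle Hp (G (X fstar)) (lambda *: G (X (f n)))) ->
  G (X (f n)) @[n --> \oo] --> G (X fstar) /\
  weak_cvg (fun n => X (f n)) (X fstar).
Proof.
move=> fl Xn Xs ratio.
have GX : G (X (f n)) @[n --> \oo] --> G (X fstar).
  by apply: (@cvg_of_ratio _ _ _ oc _ _ (G ybar)) ratio => [n|]; [case: (Xn n)|case: Xs].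
split=> //.
have [_ _ [c c0 Ac] _] := adm.
pose B := c^-1 * ((`|fstar| + 1) * `|G ybar|).
have ci0 : 0 <= c^-1 by rewrite invr_ge0 ltW.
have B0 : 0 <= B by rewrite !mulr_ge0// addr_ge0.
apply: (@weak_cvg_of_bounded _ _ _ _ _ _ (Num.sqrt B)) GX; near=> n.
rewrite -(ler_pXn2r (_ : 0 < 2)%N) ?nnegrE ?sqrtr_ge0// sqr_sqrtr//.
have [itv XE] := Xn n; rewrite -[in X in order_itv _ _ _ X]XE in itv.
have := VI_sol_bound oc adm (extend_cone oc incr _) itv c0 Ac.
rewrite XE => /le_trans; apply.
rewrite /B ler_wpM2l// ler_wpM2r//.
near: n; apply: cvgr_le (cvg_norm fl) _ _; rewrite ltrDl//.
Unshelve. all: by end_near. Qed.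

End convergence.

Theorem theorem5 (R : realType) (N : nat) (Omega : set 'rV[R]_N)
  (V H : hilbertType R) (G : gelfand V H) (Hp : set H)
  (fn : H -> RN R N -> R) (A : V -> dual V) (Phi : H -> H)
  (nu : R) (F : dual V) (ybar : V) (f : nat -> H) (fstar : H) :
  open Omega ->
  ordering_cone Hp ->
  pos_stable G Hp ->
  function_space Omega Hp fn ->
  admissible G Hp A ->
  increasing_on_cone Hp Phi ->
  0 < nu ->
  dle G Hp 0 F ->
  A ybar = F ->
  (forall n, in_Linf_nu Omega fn nu (f n)) ->
  (forall n, dle G Hp 0 (pivot G (f n)) /\ dle G Hp (pivot G (f n)) F) ->
  cvg_Linf Omega fn f fstar ->
  assumption_A Omega G Hp fn nu Phi ->
  (forall (lambda : R) (y : H), 1 < lambda -> Hp y ->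
     hle Hp (Phi (lambda *: y)) (lambda *: Phi y)) ->
  let m g := minsol G Hp A Phi ybar (pivot G g) in
  let M g := maxsol G Hp A Phi ybar (pivot G g) in
  (G (m (f n)) @[n --> \oo] --> G (m fstar) /\
   weak_cvg (fun n => m (f n)) (m fstar)) /\
  (G (M (f n)) @[n --> \oo] --> G (M fstar) /\
   weak_cvg (fun n => M (f n)) (M fstar)).
Proof.
move=> _ oc ps fs adm incr nu0 _ <- fnu fF fl _ subhom m M.
have fl_H := cvg_Linf_cvg fs fl.
have sources n : admissible_source G Hp A ybar (pivot G (f n)) := fF n.
have source_lim := admissible_source_lim fl_H sources.
have ratio := cvg_Linf_ratio fs nu0 fnu fl.
split; [apply: (QVI_sol_cvg (X := m) oc adm incr fl_H)|
  apply: (QVI_sol_cvg (X := M) oc adm incr fl_H)].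
- by move=> n; exact: (minsolP oc ps adm incr (sources n)).1.
- exact: (minsolP oc ps adm incr source_lim).1.
(* The two source inequalities, [f n] against [lambda *: fstar] and conversely, give one side of the
   ratio bound each. *)
- move=> lambda l1; apply: filterS (ratio _ l1) => n [h1 h2].
  by split; apply: (minsol_le_scale oc ps adm incr subhom) => //; exact: dle_pivot.
- by move=> n; exact: (maxsolP oc ps adm incr (sources n)).1.
- exact: (maxsolP oc ps adm incr source_lim).1.
- move=> lambda l1; apply: filterS (ratio _ l1) => n [h1 h2].
  by split; apply: (maxsol_le_scale oc ps adm incr subhom) => //; exact: dle_pivot.
Qed.
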